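(* Let $ABC$ be a nondegenerate triangle with angles $A,B,C$ and circumradius $R$. Put $$\mu=\cos^{-2}\tfrac A2+\cos^{-2}\tfrac B2+\cos^{-2}\tfrac C2,$$ and let $P,Q$ be the points with barycentric coordinates $$P=\mu^{-1}\left[\cos^{-2}\tfrac B2,\ \cos^{-2}\tfrac C2,\ \cos^{-2}\tfrac A2\right],\qquad Q=\mu^{-1}\left[\cos^{-2}\tfrac C2,\ \cos^{-2}\tfrac A2,\ \cos^{-2}\tfrac B2\right].$$ Then $$\tan^2\tfrac A2+\tan^2\tfrac B2+\tan^2\tfrac C2-\left(2-8\sin\tfrac A2\sin\tfrac B2\sin\tfrac C2\right)=\frac{\mu^2}{16R^2}|PQ|^2\ \ge\ 0 .$$
   Context: Barycentric coordinates are taken with respect to triangle $ABC$ and normalized: $[u,v,w]$ with $u+v+w=1$ denotes the point $uA+vB+wC$ (affine combination of the vertices). The notation $\cos^{-2}\theta$ means $1/\cos^2\theta$. *)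

(* Defs.v *)
From Stdlib Require Import Reals.
Open Scope R_scope.

Definition point : Type := (R * R)%type.

Definition dist_pt (X Y : point) : R := dist_euc (fst X) (snd X) (fst Y) (snd Y).

(* [(p, q) <> (0, 0)] makes [p x + q y + s = 0] the equation of a line. *)
Definition collinear (A B C : point) : Prop :=
  exists p q s : R, (p, q) <> (0, 0) /\
    p * fst A + q * snd A + s = 0 /\
    p * fst B + q * snd B + s = 0 /\
    p * fst C + q * snd C + s = 0.

Definition nondegenerate_triangle (A B C : point) : Prop := ~ collinear A B C.

(* The unoriented angle at [X] between the rays [XY] and [XZ], in [0, PI];
   meaningful only when [Y] and [Z] differ from [X]. *)
Definition angle (Y X Z : point) : R :=
  acos (((fst Y - fst X) * (fst Z - fst X) + (snd Y - snd X) * (snd Z - snd X))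
        / (dist_pt X Y * dist_pt X Z)).

Definition is_circumradius (A B C : point) (r : R) : Prop :=
  exists O : point, dist_pt O A = r /\ dist_pt O B = r /\ dist_pt O C = r.

(* The point [u A + v B + w C]; independent of the choice of origin only for
   normalized coordinates, [u + v + w = 1]. *)
Definition bary (A B C : point) (u v w : R) : point :=
  (u * fst A + v * fst B + w * fst C, u * snd A + v * snd B + w * snd C).

Definition inv_cos2 (t : R) : R := 1 / (cos t) ^ 2.

(* Main.v *)
Require Import Defs.
From Stdlib Require Import Reals.
From Stdlib Require Import Lra.
Open Scope R_scope.

(** Write [BC = y + z], [CA = z + x], [AB = x + y] with [x, y, z > 0] and
    [s = x + y + z]. The law of cosines gives [cos^2 (A/2) = s x / (CA * AB)] and
    [sin^2 (A/2) = y z / (CA * AB)], the circumradius satisfies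
    [R^2 = (BC * CA * AB)^2 / (16 s x y z)], and a vector [u A + v B + w C] with
    [u + v + w = 0] has squared length [- (BC^2 v w + CA^2 w u + AB^2 u v)].
    The equality thus becomes an identity between rational functions of [x, y, z]. *)

(** Twice the signed area of the triangle. *)
Definition cross (A B C : point) : R :=
  (fst B - fst A) * (snd C - snd A) - (snd B - snd A) * (fst C - fst A).

Lemma dist_pt_sqr (X Y : point) :
  dist_pt X Y ^ 2 = (fst X - fst Y) ^ 2 + (snd X - snd Y) ^ 2.
Proof.
  unfold dist_pt, dist_euc.
  rewrite pow2_sqrt; [unfold Rsqr; ring|].
  apply Rplus_le_le_0_compat; apply Rle_0_sqr.
Qed.

Lemma dist_pt_nonneg (X Y : point) : 0 <= dist_pt X Y.
Proof. apply sqrt_pos. Qed.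

Lemma dist_pt_sym (X Y : point) : dist_pt X Y = dist_pt Y X.
Proof. apply distance_symm. Qed.

(** By contraposition: the witness is the line [AB], or the line [AC] if [A = B], or the vertical
    line through [A] if all three points coincide. *)
Lemma cross_neq0 (A B C : point) : nondegenerate_triangle A B C -> cross A B C <> 0.
Proof.
  unfold cross; intros hnd h0; apply hnd.
  destruct (Req_dec (fst B - fst A) 0) as [hx|hx];
    [destruct (Req_dec (snd B - snd A) 0) as [hy|hy]|].
  - destruct (Req_dec (fst C - fst A) 0) as [hx'|hx'];
      [destruct (Req_dec (snd C - snd A) 0) as [hy'|hy']|].
    + exists 1, 0, (- fst A); split; [intros e; injection e; lra | repeat split; lra].
    + exists (snd C - snd A), (- (fst C - fst A)),
        (- ((snd C - snd A) * fst A - (fst C - fst A) * snd A)).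
      split; [intros e; injection e; lra | repeat split; nra].
    + exists (snd C - snd A), (- (fst C - fst A)),
        (- ((snd C - snd A) * fst A - (fst C - fst A) * snd A)).
      split; [intros e; injection e; lra | repeat split; nra].
  - exists (snd B - snd A), (- (fst B - fst A)),
      (- ((snd B - snd A) * fst A - (fst B - fst A) * snd A)).
    split; [intros e; injection e; lra | repeat split; nra].
  - exists (snd B - snd A), (- (fst B - fst A)),
      (- ((snd B - snd A) * fst A - (fst B - fst A) * snd A)).
    split; [intros e; injection e; lra | repeat split; nra].
Qed.

(** Lagrange's identity makes Cauchy-Schwarz strict when [cross] is nonzero; the law of cosines then
    compares [BC^2] with [(AB + AC)^2]. *)
Lemma strict_triangle_inequality (A B C : point) :
  cross A B C <> 0 -> dist_pt B C < dist_pt A B + dist_pt A C.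
Proof.
  intros hD.
  pose proof (dist_pt_nonneg A B) as p1.
  pose proof (dist_pt_nonneg A C) as p2.
  pose proof (dist_pt_sqr A B) as e1.
  pose proof (dist_pt_sqr A C) as e2.
  pose proof (dist_pt_sqr B C) as e3.
  set (d := (fst B - fst A) * (fst C - fst A) + (snd B - snd A) * (snd C - snd A)).
  assert (hD2 : 0 < cross A B C ^ 2) by (rewrite <- Rsqr_pow2; apply Rsqr_pos_lt; exact hD).
  assert (lagrange : (dist_pt A B * dist_pt A C) ^ 2 = d ^ 2 + cross A B C ^ 2)
    by (rewrite Rpow_mult_distr, e1, e2; unfold d, cross; ring).
  assert (cs : - d < dist_pt A B * dist_pt A C).
  { apply Rnot_le_lt; intros h.
    pose proof (Rmult_le_pos _ _ p1 p2); nra. }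
  assert (law : dist_pt B C ^ 2 = dist_pt A B ^ 2 + dist_pt A C ^ 2 - 2 * d)
    by (rewrite e1, e2, e3; unfold d; ring).
  apply Rnot_le_lt; intros h; nra.
Qed.

Lemma dot_law_of_cosines (X Y Z : point) :
  (fst Y - fst X) * (fst Z - fst X) + (snd Y - snd X) * (snd Z - snd X)
  = (dist_pt X Y ^ 2 + dist_pt X Z ^ 2 - dist_pt Y Z ^ 2) / 2.
Proof. rewrite !dist_pt_sqr; field. Qed.

Lemma half_angle (X Y Z : point) (x y z : R) :
  0 < x -> 0 < y -> 0 < z ->
  dist_pt X Y = x + y -> dist_pt X Z = x + z -> dist_pt Y Z = y + z ->
  0 <= sin (angle Y X Z / 2) /\
  sin (angle Y X Z / 2) ^ 2 = y * z / ((x + y) * (x + z)) /\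
  cos (angle Y X Z / 2) ^ 2 = x * (x + y + z) / ((x + y) * (x + z)).
Proof.
  intros hx hy hz e1 e2 e3.
  (* [q] is the expected [sin^2] of the half angle. From [0 < q < 1] the argument [1 - 2 q] of
     [acos] lies in [[-1, 1]], so [cos_acos] applies. *)
  pose (q := y * z / ((x + y) * (x + z))).
  assert (hxy : 0 < (x + y) * (x + z)) by nra.
  assert (hq0 : 0 < q) by (apply Rdiv_lt_0_compat; nra).
  assert (hq : 1 - q = x * (x + y + z) / ((x + y) * (x + z))) by (unfold q; field; lra).
  assert (hq1 : 0 < 1 - q) by (rewrite hq; apply Rdiv_lt_0_compat; nra).
  assert (hcos : cos (angle Y X Z) = 1 - 2 * q).
  { unfold angle; rewrite dot_law_of_cosines, e1, e2, e3.
    replace (_ / _ / _) with (1 - 2 * q) by (unfold q; field; lra).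
    apply cos_acos; lra. }
  assert (hrange : 0 <= angle Y X Z <= PI) by apply acos_bound.
  assert (hdbl : cos (angle Y X Z) = 1 - 2 * sin (angle Y X Z / 2) ^ 2).
  { replace (angle Y X Z) with (2 * (angle Y X Z / 2)) at 1 by field.
    rewrite cos_2a_sin; ring. }
  assert (hs : sin (angle Y X Z / 2) ^ 2 = q) by lra.
  split; [apply sin_ge_0; lra|split; [exact hs|]].
  pose proof (sin2_cos2 (angle Y X Z / 2)) as h1; unfold Rsqr in h1.
  lra.
Qed.

(** Lagrange's identity, with twice the dot product at [A] expressed through the sides and the
    resulting difference of squares factored. *)
Lemma heron (A B C : point) (x y z : R) :
  dist_pt A B = x + y -> dist_pt A C = x + z -> dist_pt B C = y + z ->
  cross A B C ^ 2 = 4 * (x + y + z) * x * y * z.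
Proof.
  intros e1 e2 e3.
  assert (h : 4 * cross A B C ^ 2 = 4 * dist_pt A B ^ 2 * dist_pt A C ^ 2
            - (dist_pt A B ^ 2 + dist_pt A C ^ 2 - dist_pt B C ^ 2) ^ 2)
    by (rewrite !dist_pt_sqr; unfold cross; ring).
  rewrite e1, e2, e3 in h; nra.
Qed.

Lemma circumradius_sqr (A B C : point) (r : R) :
  is_circumradius A B C r ->
  4 * cross A B C ^ 2 * r ^ 2 = (dist_pt A B * dist_pt A C * dist_pt B C) ^ 2.
Proof.
  intros [O [hA [hB hC]]].
  pose proof (dist_pt_sqr O A) as eA; rewrite hA in eA.
  pose proof (dist_pt_sqr O B) as eB; rewrite hB in eB.
  pose proof (dist_pt_sqr O C) as eC; rewrite hC in eC.
  rewrite !Rpow_mult_distr, !dist_pt_sqr; unfold cross.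
  destruct A as [ax ay], B as [bx by'], C as [cx cy], O as [ox oy]; cbn [fst snd] in *.
  set (u := bx - ax) in *; set (v := by' - ay) in *.
  set (u' := cx - ax) in *; set (v' := cy - ay) in *.
  set (o := ox - ax) in *; set (o' := oy - ay) in *.
  (* Subtracting the circle equations at [A] and [B], then at [A] and [C], cancels the quadratic
     terms in the centre. *)
  assert (l1 : 2 * (o * u + o' * v) = u ^ 2 + v ^ 2) by (unfold u, v, o, o' in *; lra).
  assert (l2 : 2 * (o * u' + o' * v') = u' ^ 2 + v' ^ 2) by (unfold u', v', o, o' in *; lra).
  (* Cramer's rule for the circumcentre relative to [A] *)
  assert (c1 : 2 * (u * v' - v * u') * o = (u ^ 2 + v ^ 2) * v' - (u' ^ 2 + v' ^ 2) * v)
    by (rewrite <- l1, <- l2; ring).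
  assert (c2 : 2 * (u * v' - v * u') * o' = (u' ^ 2 + v' ^ 2) * u - (u ^ 2 + v ^ 2) * u')
    by (rewrite <- l1, <- l2; ring).
  rewrite eA.
  transitivity ((2 * (u * v' - v * u') * o) ^ 2 + (2 * (u * v' - v * u') * o') ^ 2);
    [ring|].
  (* With [p = (u, v)] and [p' = (u', v')], this is [| |p|^2 p' - |p'|^2 p |^2 = |p|^2 |p'|^2 |p -
     p'|^2]. *)
  rewrite c1, c2; unfold u, v, u', v'; ring.
Qed.

(** Equal coordinate sums make the displacement a combination of side vectors, whose dot products
    are determined by the side lengths. *)
Lemma dist_pt_bary_sqr (A B C : point) (u v w u' v' w' : R) :
  u + v + w = u' + v' + w' ->
  dist_pt (bary A B C u v w) (bary A B C u' v' w') ^ 2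
  = - (dist_pt B C ^ 2 * (v - v') * (w - w') + dist_pt A C ^ 2 * (w - w') * (u - u')
       + dist_pt A B ^ 2 * (u - u') * (v - v')).
Proof.
  intros h; rewrite !dist_pt_sqr; unfold bary; cbn [fst snd].
  replace w with (u' + v' + w' - u - v) by lra; ring.
Qed.

Lemma nonneg_eq_of_sqr_eq (x y : R) : 0 <= x -> 0 <= y -> x ^ 2 = y ^ 2 -> x = y.
Proof. intros hx hy h; apply Rsqr_inj; unfold Rsqr; lra. Qed.

Theorem mainTheorem5 (A B C : point) (r : R)
  (hABC : nondegenerate_triangle A B C)
  (hr : is_circumradius A B C r) :
  let a := angle B A C in
  let b := angle C B A in
  let c := angle A C B in
  let mu := inv_cos2 (a / 2) + inv_cos2 (b / 2) + inv_cos2 (c / 2) in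
  let P := bary A B C (/ mu * inv_cos2 (b / 2)) (/ mu * inv_cos2 (c / 2))
                      (/ mu * inv_cos2 (a / 2)) in
  let Q := bary A B C (/ mu * inv_cos2 (c / 2)) (/ mu * inv_cos2 (a / 2))
                      (/ mu * inv_cos2 (b / 2)) in
  tan (a / 2) ^ 2 + tan (b / 2) ^ 2 + tan (c / 2) ^ 2
    - (2 - 8 * sin (a / 2) * sin (b / 2) * sin (c / 2))
  = mu ^ 2 / (16 * r ^ 2) * dist_pt P Q ^ 2
  /\ mu ^ 2 / (16 * r ^ 2) * dist_pt P Q ^ 2 >= 0.
Proof.
  intros a b c mu P Q.
  pose proof (cross_neq0 A B C hABC) as hD.
  (* Permuting the vertices changes [cross] at most by a sign. *)
  assert (hDb : cross B A C <> 0) by (unfold cross in *; lra).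
  assert (hDc : cross C A B <> 0) by (unfold cross in *; lra).
  pose proof (strict_triangle_inequality A B C hD) as tA.
  pose proof (strict_triangle_inequality B A C hDb) as tB.
  pose proof (strict_triangle_inequality C A B hDc) as tC.
  rewrite (dist_pt_sym B A) in tB.
  rewrite (dist_pt_sym C A), (dist_pt_sym C B) in tC.
  (* [x], [y], [z] are the tangent lengths from [A], [B], [C] to the incircle, positive by the
     strict triangle inequalities. *)
  pose (x := (dist_pt A B + dist_pt A C - dist_pt B C) / 2).
  pose (y := (dist_pt A B + dist_pt B C - dist_pt A C) / 2).
  pose (z := (dist_pt A C + dist_pt B C - dist_pt A B) / 2).
  assert (hx : 0 < x) by (unfold x; lra).
  assert (hy : 0 < y) by (unfold y; lra).
  assert (hz : 0 < z) by (unfold z; lra).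
  assert (eAB : dist_pt A B = x + y) by (unfold x, y; lra).
  assert (eAC : dist_pt A C = x + z) by (unfold x, z; lra).
  assert (eBC : dist_pt B C = y + z) by (unfold y, z; lra).
  clearbody x y z.
  pose proof (heron A B C x y z eAB eAC eBC) as hH.
  pose proof (circumradius_sqr A B C r hr) as hR.
  rewrite hH, eAB, eAC, eBC in hR.
  destruct (half_angle A B C x y z hx hy hz eAB eAC eBC) as [sa0 [sa ca]].
  destruct (half_angle B C A y z x hy hz hx) as [sb0 [sb cb]];
    [lra | rewrite dist_pt_sym; lra | rewrite dist_pt_sym; lra |].
  destruct (half_angle C A B z x y hz hx hy) as [sc0 [sc cc]];
    [rewrite dist_pt_sym; lra | rewrite dist_pt_sym; lra | lra |].
  fold a in sa0, sa, ca; fold b in sb0, sb, cb; fold c in sc0, sc, cc.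
  assert (tan_sqr : forall t, tan t ^ 2 = sin t ^ 2 / cos t ^ 2)
    by (intros t; unfold tan, Rdiv; rewrite Rpow_mult_distr, pow_inv; reflexivity).
  assert (hsin : sin (a / 2) * sin (b / 2) * sin (c / 2)
                 = x * y * z / ((x + y) * (y + z) * (z + x))).
  { apply nonneg_eq_of_sqr_eq.
    - repeat apply Rmult_le_pos; assumption.
    - apply Rlt_le, Rdiv_lt_0_compat; repeat apply Rmult_lt_0_compat; lra.
    - rewrite !Rpow_mult_distr, sa, sb, sc; field; lra. }
  assert (ia : inv_cos2 (a / 2) = (x + y) * (x + z) / (x * (x + y + z)))
    by (unfold inv_cos2; rewrite ca; field; lra).
  assert (ib : inv_cos2 (b / 2) = (y + z) * (y + x) / (y * (x + y + z)))
    by (unfold inv_cos2; rewrite cb; field; lra).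
  assert (ic : inv_cos2 (c / 2) = (z + x) * (z + y) / (z * (x + y + z)))
    by (unfold inv_cos2; rewrite cc; field; lra).
  assert (hmu : 0 < mu).
  { unfold mu; rewrite ia, ib, ic.
    repeat apply Rplus_lt_0_compat; apply Rdiv_lt_0_compat;
      apply Rmult_lt_0_compat; lra. }
  assert (hS : 0 < (x + y + z) * x * y * z) by (repeat apply Rmult_lt_0_compat; lra).
  assert (hr2 : r ^ 2 = ((x + y) * (x + z) * (y + z)) ^ 2
                        / (16 * ((x + y + z) * x * y * z))).
  { rewrite <- hR; field; lra. }
  assert (hr2pos : 0 < r ^ 2).
  { rewrite hr2; apply Rdiv_lt_0_compat; [|lra].
    apply pow_lt; repeat apply Rmult_lt_0_compat; lra. }
  split.
  (* The coordinates of [P] and [Q] permute the same three numbers, so their sums agree; the factor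
     [mu ^ 2] clears the normalization. *)
  - assert (hPQ : mu ^ 2 * dist_pt P Q ^ 2
      = - ((y + z) ^ 2 * (inv_cos2 (c / 2) - inv_cos2 (a / 2))
                       * (inv_cos2 (a / 2) - inv_cos2 (b / 2))
           + (x + z) ^ 2 * (inv_cos2 (a / 2) - inv_cos2 (b / 2))
                         * (inv_cos2 (b / 2) - inv_cos2 (c / 2))
           + (x + y) ^ 2 * (inv_cos2 (b / 2) - inv_cos2 (c / 2))
                         * (inv_cos2 (c / 2) - inv_cos2 (a / 2)))).
    { unfold P, Q; rewrite dist_pt_bary_sqr by ring.
      rewrite eAB, eAC, eBC; field; lra. }
    replace (mu ^ 2 / (16 * r ^ 2) * dist_pt P Q ^ 2)
      with (mu ^ 2 * dist_pt P Q ^ 2 / (16 * r ^ 2)) by (field; nra).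
    rewrite hPQ, hr2, !tan_sqr, sa, sb, sc, ca, cb, cc, ia, ib, ic.
    (* Regrouping exposes the product of sines, the only trigonometric term still to be made
       rational. *)
    replace (8 * sin (a / 2) * sin (b / 2) * sin (c / 2))
      with (8 * (sin (a / 2) * sin (b / 2) * sin (c / 2))) by ring.
    rewrite hsin; field; repeat split; lra.
  - apply Rle_ge, Rmult_le_pos; [|apply pow2_ge_0].
    apply Rlt_le, Rdiv_lt_0_compat; [apply pow_lt; exact hmu | lra].
Qed.
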